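(* Let $r>0$ and $\alpha=e^{-r}$. Then the positive equilibrium $x^{*}=\frac{1}{1-\alpha}$ of the delay logistic equation $$\frac{d}{dt}x(t)=r\,x(t)\left(1+\alpha x(t)-x(t-1)\right)$$ is unstable.
   Context: Initial conditions are positive continuous functions $\phi:[-1,0]\to(0,\infty)$, with $x(\theta)=\phi(\theta)$ for $\theta\in[-1,0]$, in the space $C([-1,0],\mathbb{R})$ with the norm $\|\phi\|=\sup_{-1\le\theta\le0}|\phi(\theta)|$. The equation has a unique positive equilibrium, $x^*=\frac{1}{1-\alpha}$, if and only if $\alpha<1$. Unstable means not (Lyapunov) stable: the equilibrium is stable if for every $\varepsilon>0$ there is $\delta>0$ such that every solution whose initial function satisfies $\|\phi-x^*\|<\delta$ exists for all $t\ge0$ and satisfies $|x(t)-x^*|<\varepsilon$ for all $t\ge0$. *)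

(* Defs.v *)
From Stdlib Require Import Reals Lra.
From Coquelicot Require Import Coquelicot.
Open Scope R_scope.

(** The delay logistic equation is [x'(t) = delay_logistic r alpha (x t) (x (t - 1))]. *)
Definition delay_logistic (r alpha u v : R) : R := r * u * (1 + alpha * u - v).

Definition history (theta : R) : Prop := -1 <= theta <= 0.

(** Supremum norm of [C([-1,0])]; functions on [-1,0] are represented by total
    functions whose values outside [-1,0] play no role.  The least upper bound
    is finite for functions continuous on [-1,0]. *)
Definition sup_norm (phi : R -> R) : R :=
  real (Lub_Rbar (fun y => exists theta, history theta /\ y = Rabs (phi theta))).

(** [continuous_on] is continuity relative to the given set, hence one-sided
    at the end points of [-1,0]. *)
Definition initial_function (phi : R -> R) : Prop :=
  continuous_on history phi /\ (forall theta, history theta -> 0 < phi theta).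

(** Solution on [-1,+oo) with initial function [phi].  Given the continuity of
    [x], the equation on (0,+oo) implies it at [t = 0] for the right-hand
    derivative. *)
Definition global_solution (r alpha : R) (phi x : R -> R) : Prop :=
  continuous_on (fun t => -1 <= t) x /\
  (forall theta, history theta -> x theta = phi theta) /\
  (forall t, 0 < t -> is_derive x t (delay_logistic r alpha (x t) (x (t - 1)))).

(** Lyapunov stability.  Initial value problems have unique solutions, so that
    "every solution exists for all [t >= 0]" is the existence of a global
    solution for every admissible [phi]; solutions blowing up in finite time
    thus violate stability. *)
Definition stable (r alpha c : R) : Prop :=
  forall eps, 0 < eps ->
  exists delta, 0 < delta /\
  forall phi, initial_function phi ->
    sup_norm (fun theta => phi theta - c) < delta ->
    (exists x, global_solution r alpha phi x) /\
    (forall x, global_solution r alpha phi x ->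
       forall t, 0 <= t -> Rabs (x t - c) < eps).

Definition unstable (r alpha c : R) : Prop := ~ stable r alpha c.

Definition positive_equilibrium (r alpha c : R) : Prop :=
  0 < c /\ delay_logistic r alpha c c = 0.

Lemma positive_equilibriumE (r alpha c : R) :
  0 < r -> alpha < 1 -> (positive_equilibrium r alpha c <-> c = 1 / (1 - alpha)).
Proof.
intros Hr Ha; unfold positive_equilibrium, delay_logistic; split.
- intros [Hc H].
  destruct (Rmult_integral _ _ H) as [H1|H1].
  + destruct (Rmult_integral _ _ H1); lra.
  + apply (Rmult_eq_reg_r (1 - alpha)); [|lra].
    unfold Rdiv; rewrite Rmult_assoc, Rinv_l; lra.
- intros ->; split.
  + apply Rdiv_lt_0_compat; lra.
  + field; lra.
Qed.

(* Main.v *)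
Require Import Defs.
From Stdlib Require Import Reals Lra Lia List Ranalysis5.
From Coquelicot Require Import Coquelicot.
Open Scope R_scope.

(** With [q = r / (1 - alpha)] and [p = q alpha], the deviation [z = x - x*] satisfies
    [z' = p z - q z(t-1) + r z (alpha z - z(t-1))].  The inequality
    [w tan (w/2) < - ln cos w] at [cos w = alpha] gives the linear part a complex eigenvalue
    with positive real part.  An eigenvalue [mu + i om] with [mu] larger than half of the
    supremum of the real parts is nonresonant: no characteristic root has real part
    [k mu], [k >= 2].  Hence Picard iteration in the space of sums of exponentials
    [Re (c e^((k mu + i nu) t))], [k >= 1], with the l1-norm of the amplitudes, converges to a
    nonzero solution on [(-oo,0)] that tends to [0] at [-oo].  Started at a very negative
    time, this solution is arbitrarily close to the equilibrium, yet by uniqueness it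
    always reaches the same fixed distance from it. *)

(** * Trigonometric inequalities *)

Lemma increasing_of_derive (f df : R -> R) (a b : R) :
  a < b ->
  (forall x, a <= x <= b -> is_derive f x (df x)) ->
  (forall x, a < x < b -> 0 < df x) ->
  f a < f b.
Proof.
intros hab hd hpos.
destruct (MVT_cor2 f df a b hab) as [c [hc hcab]].
- intros x hx; apply is_derive_Reals; auto.
- assert (0 < df c * (b - a)) by (apply Rmult_lt_0_compat; [auto | lra]).
  lra.
Qed.

Lemma mul_cos_lt_sin (w : R) : 0 < w <= PI -> w * cos w < sin w.
Proof.
intros hw.
assert (h : sin 0 - 0 * cos 0 < sin w - w * cos w).
{ apply (increasing_of_derive (fun x => sin x - x * cos x) (fun x => x * sin x)); [lra | |].
  - intros x _; auto_derive; [trivial | ring].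
  - intros x hx; apply Rmult_lt_0_compat; [lra | apply sin_gt_0; lra]. }
rewrite sin_0 in h; lra.
Qed.

(** The derivative of [- sin x / x] has numerator [sin x - x cos x], positive by
    [mul_cos_lt_sin]. *)
Lemma sinc_decreasing (a b : R) : 0 < a < b -> b <= PI -> sin b / b < sin a / a.
Proof.
intros hab hb.
assert (h : - (sin a / a) < - (sin b / b)); [|lra].
apply (increasing_of_derive (fun x => - (sin x / x))
         (fun x => (sin x - x * cos x) / (x * x))); [lra | |].
- intros x hx; auto_derive; [lra | field; lra].
- intros x hx; apply Rdiv_lt_0_compat; [|nra].
  assert (h := mul_cos_lt_sin x); lra.
Qed.

(** Both sides vanish at [0], and half-angle formulas turn the derivative of their difference into
    [(tan x - x) / (2 cos^2 (x/2))], which is positive. *)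
Lemma mul_tan_half_lt_ln_cos (w : R) :
  0 < w < PI / 2 -> w * (sin (w / 2) / cos (w / 2)) < - ln (cos w).
Proof.
intros hw.
assert (h : - ln (cos 0) - 0 * (sin (0 / 2) / cos (0 / 2))
            < - ln (cos w) - w * (sin (w / 2) / cos (w / 2))).
{ apply (increasing_of_derive
    (fun x => - ln (cos x) - x * (sin (x / 2) / cos (x / 2)))
    (fun x => (sin x / cos x - x) / (2 * (cos (x / 2) * cos (x / 2))))); [lra | |].
  - intros x hx.
    assert (h1 : 0 < cos x) by (apply cos_gt_0; lra).
    assert (h2 : 0 < cos (x / 2)) by (apply cos_gt_0; lra).
    auto_derive; [repeat split; lra |].
    assert (hs : sin x = 2 * sin (x / 2) * cos (x / 2))
      by (rewrite <- sin_2a; f_equal; field).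
    assert (hc : cos x = 2 * cos (x / 2) * cos (x / 2) - 1)
      by (rewrite <- cos_2a_cos; f_equal; field).
    assert (hp := sin2_cos2 (x / 2)); unfold Rsqr in hp.
    change (x * / 2) with (x / 2).
    rewrite hs, hc in *.
    set (s := sin (x / 2)) in *; set (c := cos (x / 2)) in *.
    match goal with |- ?e = _ =>
      replace e with (2 * s * c / (2 * c * c - 1) - s / c - x * (s * s + c * c) / (2 * (c * c)))
        by (field; lra) end.
    rewrite hp; field; lra.
  - intros x hx.
    assert (h1 : 0 < cos x) by (apply cos_gt_0; lra).
    assert (h2 : 0 < cos (x / 2)) by (apply cos_gt_0; lra).
    apply Rdiv_lt_0_compat; [|nra].
    assert (h := mul_cos_lt_sin x).
    assert (x < sin x / cos x); [|lra].
    apply (Rmult_lt_reg_r (cos x)); [lra|].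
    replace (sin x / cos x * cos x) with (sin x) by (field; lra); lra. }
rewrite cos_0, ln_1 in h; lra.
Qed.

(** * An eigenvalue with positive real part *)

(** The characteristic function [zeta - p + q e^(-zeta)] of [y' = p y - q y(t-1)]
    at [zeta = s + i nu]. *)
Definition char_fun (p q s nu : R) : C :=
  (s - p + q * (exp (- s) * cos nu), nu - q * (exp (- s) * sin nu)).

(* Parametrising the solutions of [Im (char_fun) = 0] by the frequency gives
   [e^s = q sin nu / nu], and it remains to find a sign change of the real part. *)
Lemma unstable_root (r a : R) :
  0 < r -> a = exp (- r) ->
  exists s nu, 0 < s /\ char_fun (r / (1 - a) * a) (r / (1 - a)) s nu = 0%C.
Proof.
intros hr ha.
assert (ha0 : 0 < a) by (rewrite ha; apply exp_pos).
assert (ha1 : a < 1) by (rewrite ha, <- exp_0; apply exp_increasing; lra).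
set (q := r / (1 - a)).
assert (hq0 : 0 < q) by (apply Rdiv_lt_0_compat; lra).
(* Indeed [q a = r / (e^r - 1)], and [r < e^r - 1]. *)
assert (hqa : q * a < 1).
{ unfold q; apply (Rmult_lt_reg_r (1 - a)); [lra|].
  replace (r / (1 - a) * a * (1 - a)) with (r * a) by (field; lra).
  assert (h := exp_ineq1 r ltac:(lra)).
  assert (a * exp r = 1) by (rewrite ha, <- exp_plus, <- exp_0; f_equal; lra).
  nra. }
set (w0 := acos a).
assert (hc0 : cos w0 = a) by (apply cos_acos; lra).
assert (hw0 : 0 < w0 < PI / 2).
{ assert (hb := acos_bound_lt a ltac:(lra)); fold w0 in hb; split; [lra|].
  apply cos_decreasing_0; try lra; rewrite cos_PI2, hc0; exact ha0. }
assert (hs0 : 0 < sin w0) by (apply sin_gt_0; lra).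
(* By half-angle formulas [q sin w0 = r / tan (w0/2)], so the claim is
   [w0 tan (w0/2) < r = - ln (cos w0)]. *)
assert (hk : w0 < q * sin w0).
{ assert (h := mul_tan_half_lt_ln_cos w0 hw0).
  rewrite hc0, ha, ln_exp, Ropp_involutive in h.
  assert (hh : 0 < cos (w0 / 2)) by (apply cos_gt_0; lra).
  assert (hc : a = 1 - 2 * sin (w0 / 2) * sin (w0 / 2))
    by (rewrite <- hc0, <- cos_2a_sin; f_equal; field).
  assert (hs : sin w0 = 2 * sin (w0 / 2) * cos (w0 / 2))
    by (rewrite <- sin_2a; f_equal; field).
  unfold q; set (s := sin (w0 / 2)) in *; set (c := cos (w0 / 2)) in *.
  assert (hsp : 0 < s) by (apply sin_gt_0; lra).
  rewrite hs; replace (1 - a) with (2 * s * s) by lra.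
  replace (r / (2 * s * s) * (2 * s * c)) with (r * (c / s)) by (field; lra).
  replace w0 with (w0 * (s / c) * (c / s)) by (field; lra).
  apply Rmult_lt_compat_r; [apply Rdiv_lt_0_compat; lra | exact h]. }
(* At [w1] the parametrisation gives [e^s = 1], so the curve meets the imaginary axis there. *)
destruct (IVT_interv (fun w => w - q * sin w) w0 PI) as [w1 [hw1 e1]].
{ intros w _; apply continuity_pt_filterlim, (ex_derive_continuous (fun w => w - q * sin w)).
  auto_derive; trivial. }
{ lra. } { lra. } { rewrite sin_PI; lra. }
assert (hw01 : w0 < w1) by (destruct (Req_dec w0 w1); subst; lra).
assert (hs1 : 0 < sin w1) by (apply (Rmult_lt_reg_l q); lra).
assert (hq1 : q = w1 / sin w1).
{ apply (Rmult_eq_reg_r (sin w1)); [|lra].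
  replace (w1 / sin w1 * sin w1) with w1 by (field; lra); lra. }
assert (h1 : q * sin w1 / w1 = 1) by (rewrite hq1; field; lra).
assert (hw1' : w1 < PI).
{ destruct (Req_dec w1 PI) as [e|]; [rewrite e, sin_PI in hs1|]; lra. }
assert (hsin : forall w, w0 <= w <= w1 -> 0 < sin w) by (intros; apply sin_gt_0; lra).
(* Minus the real part of [char_fun] along the curve [s = ln (q sin w / w)]; the minus sign gives
   the order of signs that [IVT_interv] expects. *)
set (h := fun w => - (ln (q * sin w / w) - q * a + w * (cos w / sin w))).
destruct (IVT_interv h w0 w1) as [w [hw e]].
- intros w hw; assert (hs := hsin w hw).
  apply continuity_pt_filterlim, (ex_derive_continuous h); unfold h; auto_derive.
  repeat split; try lra.
  apply Rdiv_lt_0_compat; [apply Rmult_lt_0_compat|]; lra.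
- exact hw01.
(* Here [m] is the value of [s] at [w0]. Since [w0 cot w0 = q a e^(-m)], the real part is
   [m - q a (1 - e^(-m)) >= m (1 - q a) > 0]. *)
- unfold h; set (m := ln (q * sin w0 / w0)).
  assert (hm : 0 < m).
  { unfold m; rewrite <- ln_1; apply ln_increasing; [lra|].
    apply (Rmult_lt_reg_r w0); [lra|].
    replace (q * sin w0 / w0 * w0) with (q * sin w0) by (field; lra); lra. }
  assert (hem : exp (- m) * (q * sin w0) = w0).
  { unfold m; rewrite exp_Ropp, exp_ln; [field; lra|].
    apply Rdiv_lt_0_compat; lra. }
  assert (hE := exp_ineq1_le (- m)).
  rewrite hc0.
  replace (w0 * (a / sin w0)) with (exp (- m) * (q * a))
    by (apply (Rmult_eq_reg_r (sin w0)); [|lra]; field_simplify; [|lra]; nra).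
  assert (0 < q * a) by nra.
  nra.
(* At [w1] the real part is [q (cos w1 - a)], negative because [cos w1 < cos w0 = a]. *)
- unfold h.
  rewrite h1, ln_1.
  replace (w1 * (cos w1 / sin w1)) with (q * cos w1) by (rewrite hq1; field; lra).
  assert (cos w1 < cos w0) by (apply cos_decreasing_1; lra).
  nra.
- assert (hww : w < w1).
  { destruct (Req_dec w w1) as [ew|]; [exfalso|lra].
    unfold h in e; rewrite ew in e.
    rewrite h1, ln_1 in e.
    replace (w1 * (cos w1 / sin w1)) with (q * cos w1) in e by (rewrite hq1; field; lra).
    assert (cos w1 < cos w0) by (apply cos_decreasing_1; lra).
    nra. }
  assert (hs := hsin w hw).
  (* This is [s > 0]: [q sin w / w] decreases to its value [1] at [w1]. *)
  assert (hgt : 1 < q * sin w / w).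
  { assert (hd := sinc_decreasing w w1 ltac:(lra) ltac:(lra)).
    rewrite <- h1; unfold Rdiv in *; rewrite !(Rmult_assoc q).
    apply Rmult_lt_compat_l; lra. }
  exists (ln (q * sin w / w)), w; split.
  + rewrite <- ln_1; apply ln_increasing; lra.
  + assert (hE : exp (- ln (q * sin w / w)) = w / (q * sin w)).
    { rewrite exp_Ropp, exp_ln by lra; field; lra. }
    unfold char_fun; rewrite hE; unfold h in e; apply injective_projections; simpl.
    * replace (q * (w / (q * sin w) * cos w)) with (w * (cos w / sin w)) by (field; lra); lra.
    * field; lra.
Qed.

(** * Nonresonance and lower bounds for the characteristic function *)

Lemma exp_opp_bound (s : R) : 0 <= s -> 0 < exp (- s) <= 1.
Proof.
intros hs; split; [apply exp_pos|].
rewrite <- exp_0; destruct hs as [hs|<-]; [left; apply exp_increasing; lra | right; f_equal; ring].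
Qed.

(** In the right half-plane [q e^(-zeta)] has modulus at most [q]. This bounds the real parts of the
    roots and, with [char_fun_Im_ge], leaves only a bounded region in which [char_fun] may be
    small. *)
Lemma char_fun_Re_ge (p q s nu : R) :
  0 <= q -> 0 <= s -> s - p - q <= fst (char_fun p q s nu).
Proof.
intros hq hs; simpl.
assert (h1 := exp_opp_bound s hs).
assert (h2 := COS_bound nu).
assert (-1 <= exp (- s) * cos nu) by nra.
nra.
Qed.

Lemma char_fun_Im_ge (p q s nu : R) :
  0 <= q -> 0 <= s -> Rabs nu - q <= Rabs (snd (char_fun p q s nu)).
Proof.
intros hq hs; simpl.
assert (h1 := exp_opp_bound s hs).
assert (h2 := SIN_bound nu).
assert (h3 : Rabs (q * (exp (- s) * sin nu)) <= q).
{ rewrite Rabs_mult, (Rabs_pos_eq q) by lra.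
  assert (Rabs (exp (- s) * sin nu) <= 1) by (apply Rabs_le; nra).
  nra. }
assert (h4 := Rabs_triang_inv nu (q * (exp (- s) * sin nu))); lra.
Qed.

Lemma nonresonant_root (p q : R) :
  0 <= q -> (exists s nu, 0 < s /\ char_fun p q s nu = 0%C) ->
  exists mu om, 0 < mu /\ char_fun p q mu om = 0%C /\
    forall s nu, 2 * mu <= s -> char_fun p q s nu <> 0%C.
Proof.
intros hq [s0 [nu0 [hs0 e0]]].
destruct (completeness (fun s => 0 < s /\ exists nu, char_fun p q s nu = 0%C)) as [S [hub hlub]].
- exists (p + q); intros s [hs [nu e]].
  assert (h := char_fun_Re_ge p q s nu hq ltac:(lra)); rewrite e in h; simpl in h; lra.
- exists s0; eauto.
- assert (hS : s0 <= S) by (apply hub; eauto).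
  (* Otherwise [S / 2] would be a smaller upper bound. Any root with real part above [S / 2] serves:
     twice that real part exceeds [S]. *)
  assert (hex : exists mu, S / 2 < mu /\ 0 < mu /\ exists om, char_fun p q mu om = 0%C).
  { apply Classical_Prop.NNPP; intros hn.
    assert (S <= S / 2); [|lra].
    apply hlub; intros s [hs hr].
    destruct (Rle_lt_dec s (S / 2)) as [|hlt]; [assumption|].
    exfalso; apply hn; eauto. }
  destruct hex as [mu [hmu [hpos [om e]]]].
  exists mu, om; repeat split; try assumption.
  intros s nu hs es.
  assert (s <= S) by (apply hub; split; [lra | eauto]); lra.
Qed.

(** For [|nu| <= q + 1] the modulus attains a positive minimum; beyond, the imaginary part alone is
    at least [1]. *)
Lemma char_fun_lower_bound_line (p q s : R) :
  0 <= q -> 0 <= s -> (forall nu, char_fun p q s nu <> 0%C) ->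
  exists c, 0 < c /\ forall nu, c <= Cmod (char_fun p q s nu).
Proof.
intros hq hs hne.
destruct (continuity_ab_min (fun nu => Cmod (char_fun p q s nu)) (- (q + 1)) (q + 1))
  as [m [hm _]].
- lra.
- intros nu _; apply (continuity_pt_comp
    (fun nu => fst (char_fun p q s nu) ^ 2 + snd (char_fun p q s nu) ^ 2) sqrt).
  + apply continuity_pt_filterlim,
      (ex_derive_continuous (fun nu => fst (char_fun p q s nu) ^ 2 + snd (char_fun p q s nu) ^ 2)).
    simpl; auto_derive; trivial.
  + apply continuity_pt_sqrt; nra.
- exists (Rmin 1 (Cmod (char_fun p q s m))); split.
  + apply Rmin_pos; [lra|]. apply Cmod_gt_0, hne.
  + intros nu; destruct (Rle_lt_dec (Rabs nu) (q + 1)) as [h|h].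
    * eapply Rle_trans; [apply Rmin_r|]. apply hm, Rabs_le_between, h.
    * eapply Rle_trans; [apply Rmin_l|].
      eapply Rle_trans; [|apply Rmax_Cmod].
      eapply Rle_trans; [|apply Rmax_r].
      assert (hi := char_fun_Im_ge p q s nu hq hs); lra.
Qed.

(** The bound must be uniform in [k] to control the divisions of the Picard iteration. Finitely many
    lines are treated one by one; further to the right the real part exceeds [1]. *)
Lemma char_fun_lower_bound (p q mu : R) :
  0 <= q -> 0 < mu -> (forall s nu, 2 * mu <= s -> char_fun p q s nu <> 0%C) ->
  exists c, 0 < c /\
    forall k nu, c <= Cmod (char_fun p q (INR (S (S k)) * mu) nu).
Proof.
intros hq hmu hne.
assert (hS : forall k, 2 * mu <= INR (S (S k)) * mu).
{ intros k; rewrite !S_INR; assert (h := pos_INR k); nra. }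
assert (hfin : forall n, exists c, 0 < c /\ forall k nu, (k < n)%nat ->
          c <= Cmod (char_fun p q (INR (S (S k)) * mu) nu)).
{ induction n as [|n [c [hc h]]].
  - exists 1; split; [lra | intros; lia].
  - destruct (char_fun_lower_bound_line p q (INR (S (S n)) * mu)) as [c' [hc' h']]; auto.
    { specialize (hS n); lra. }
    exists (Rmin c c'); split; [now apply Rmin_pos|].
    intros k nu hk; destruct (Nat.eq_dec k n) as [->|].
    + eapply Rle_trans; [apply Rmin_r | apply h'].
    + eapply Rle_trans; [apply Rmin_l | apply h; lia]. }
destruct (INR_unbounded ((p + q + 1) / mu)) as [n hn].
destruct (hfin n) as [c [hc h]].
exists (Rmin c 1); split; [apply Rmin_pos; lra|].
intros k nu; destruct (Nat.lt_ge_cases k n) as [hk|hk].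
- eapply Rle_trans; [apply Rmin_l | now apply h].
- eapply Rle_trans; [apply Rmin_r|].
  assert (hk' := le_INR _ _ hk).
  assert (p + q + 1 < INR (S (S k)) * mu).
  { rewrite !S_INR.
    apply (Rmult_lt_compat_r mu) in hn; [|lra].
    replace ((p + q + 1) / mu * mu) with (p + q + 1) in hn by (field; lra).
    nra. }
  eapply Rle_trans; [|apply Rmax_Cmod].
  eapply Rle_trans; [|apply Rmax_l].
  eapply Rle_trans; [|apply Rle_abs].
  specialize (hS k).
  assert (hr := char_fun_Re_ge p q (INR (S (S k)) * mu) nu hq ltac:(lra)); lra.
Qed.

(** * Real exponentials *)

(** [expo s nu c t] is the real part of [c e^((s + i nu) t)]. *)
Definition expo (s nu : R) (c : C) (t : R) : R :=
  exp (s * t) * (fst c * cos (nu * t) - snd c * sin (nu * t)).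

Lemma expo_bound (s nu : R) (c : C) (t : R) :
  Rabs (expo s nu c t) <= Cmod c * exp (s * t).
Proof.
unfold expo; rewrite Rabs_mult, (Rabs_pos_eq (exp _)) by (left; apply exp_pos).
rewrite Rmult_comm; apply Rmult_le_compat_r; [left; apply exp_pos|].
(* The trigonometric factor is the real part of [c e^(i nu t)], whose modulus is [Cmod c]. *)
assert (h := Rmax_Cmod (c * (cos (nu * t), sin (nu * t)))%C).
rewrite Cmod_mult in h.
replace (Cmod (cos (nu * t), sin (nu * t))) with 1 in h.
- rewrite Rmult_1_r in h; eapply Rle_trans; [|exact h]; apply Rmax_l.
- unfold Cmod; simpl; rewrite !Rmult_1_r, Rplus_comm.
  assert (hp := sin2_cos2 (nu * t)); unfold Rsqr in hp; rewrite hp, sqrt_1; reflexivity.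
Qed.

(** This is [Re u Re v = Re (u v + u conj(v)) / 2]: rates add, frequencies add and subtract. *)
Lemma expo_mult (s nu s' nu' : R) (c c' : C) (t : R) :
  expo s nu c t * expo s' nu' c' t =
  expo (s + s') (nu + nu') (c * c' / 2)%C t + expo (s + s') (nu - nu') (c * Cconj c' / 2)%C t.
Proof.
unfold expo.
replace ((nu + nu') * t) with (nu * t + nu' * t) by ring.
replace ((nu - nu') * t) with (nu * t - nu' * t) by ring.
rewrite cos_plus, sin_plus, cos_minus, sin_minus, Rmult_plus_distr_r, exp_plus.
simpl; field.
Qed.

(** [e^(-zeta)] for [zeta = s + i nu] *)
Definition shift_factor (s nu : R) : C := (exp (- s) * cos nu, - (exp (- s) * sin nu)).

Lemma expo_shift (s nu : R) (c : C) (t : R) :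
  expo s nu c (t - 1) = expo s nu (c * shift_factor s nu)%C t.
Proof.
unfold expo.
replace (s * (t - 1)) with (s * t + - s) by ring.
replace (nu * (t - 1)) with (nu * t - nu) by ring.
rewrite exp_plus, cos_minus, sin_minus; simpl; ring.
Qed.

Lemma expo_derive (s nu : R) (c : C) (t : R) :
  is_derive (expo s nu c) t (expo s nu (c * (s, nu))%C t).
Proof. unfold expo; auto_derive; [trivial | simpl; ring]. Qed.

(** Hence dividing an amplitude by [char_fun] solves the linear equation with an exponential
    forcing, and a root of [char_fun] gives a solution without forcing. *)
Lemma expo_char (p q s nu : R) (c : C) (t : R) :
  is_derive (expo s nu c) t
    (p * expo s nu c t - q * expo s nu c (t - 1) + expo s nu (c * char_fun p q s nu)%C t).
Proof.
replace (_ + _) with (expo s nu (c * (s, nu))%C t); [apply expo_derive|].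
rewrite expo_shift; unfold expo, char_fun, shift_factor; simpl; ring.
Qed.

Lemma shift_factor_bound (s nu : R) :
  0 <= s -> Cmod (shift_factor s nu) <= 1.
Proof.
intros hs; unfold Cmod, shift_factor.
apply Rle_trans with (sqrt 1); [apply sqrt_le_1_alt; simpl | rewrite sqrt_1; lra].
assert (h1 := exp_opp_bound s hs).
assert (hp := sin2_cos2 nu); unfold Rsqr in hp.
replace (_ + _) with (exp (- s) * exp (- s) * (sin nu * sin nu + cos nu * cos nu)) by ring.
rewrite hp; nra.
Qed.

(** * Lists of modes and the operations of the iteration *)

Record mode := Mode { deg : nat; freq : R; amp : C }.

(** A list of modes stands for the sum of its real exponentials, of rates [(deg + 1) mu]. *)
Definition eval (mu : R) (l : list mode) (t : R) : R :=
  fold_right (fun m acc => expo (INR (S (deg m)) * mu) (freq m) (amp m) t + acc) 0 l.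

Definition norm1 (l : list mode) : R :=
  fold_right (fun m acc => Cmod (amp m) + acc) 0 l.

Lemma eval_cons (mu : R) (m : mode) (l : list mode) (t : R) :
  eval mu (m :: l) t = expo (INR (S (deg m)) * mu) (freq m) (amp m) t + eval mu l t.
Proof. reflexivity. Qed.

Lemma norm1_cons (m : mode) (l : list mode) : norm1 (m :: l) = Cmod (amp m) + norm1 l.
Proof. reflexivity. Qed.

Lemma eval_app (mu : R) (l l' : list mode) (t : R) :
  eval mu (l ++ l') t = eval mu l t + eval mu l' t.
Proof. induction l as [|m l IH]; simpl in *; [|rewrite IH]; ring. Qed.

Lemma norm1_app (l l' : list mode) : norm1 (l ++ l') = norm1 l + norm1 l'.
Proof. induction l as [|m l IH]; simpl in *; [|rewrite IH]; ring. Qed.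

Lemma norm1_ge_0 (l : list mode) : 0 <= norm1 l.
Proof. induction l as [|m l IH]; simpl; [lra|]. assert (h := Cmod_ge_0 (amp m)); lra. Qed.

(** All rates are at least [mu], so for [t <= 0] every exponential is dominated by [e^(mu t)]. *)
Lemma eval_bound (mu : R) (l : list mode) (t : R) :
  0 <= mu -> t <= 0 -> Rabs (eval mu l t) <= norm1 l * exp (mu * t).
Proof.
intros hmu ht; induction l as [|m l IH].
- simpl; rewrite Rabs_R0; lra.
- rewrite eval_cons, norm1_cons.
  eapply Rle_trans; [apply Rabs_triang|].
  rewrite Rmult_plus_distr_r; apply Rplus_le_compat; [|exact IH].
  eapply Rle_trans; [apply expo_bound|].
  apply Rmult_le_compat_l; [apply Cmod_ge_0|].
  assert (h : INR (S (deg m)) * mu * t <= mu * t).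
  { rewrite S_INR; assert (h := pos_INR (deg m)).
    assert (0 <= INR (deg m) * mu) by nra. nra. }
  destruct h as [h|h]; [left; now apply exp_increasing | right; now rewrite h].
Qed.

Lemma eval_continuity (mu : R) (l : list mode) (t : R) : continuity_pt (eval mu l) t.
Proof.
apply continuity_pt_filterlim, (ex_derive_continuous (eval mu l)).
induction l as [|m l IH].
- apply ex_derive_const.
- apply (@ex_derive_plus R_AbsRing R_NormedModule); [|exact IH].
  eexists; apply expo_derive.
Qed.

(** The operator [z |-> r (a z - z(t-1))] is diagonal on modes, with multiplier [r (a - e^(-zeta))];
    [2 r] bounds the multiplier in [norm1_lag]. *)
Definition lag (r a mu : R) (l : list mode) : list mode :=
  map (fun m => Mode (deg m) (freq m)
    (RtoC r * (a - shift_factor (INR (S (deg m)) * mu) (freq m)) * amp m)%C) l.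

Lemma eval_lag (r a mu : R) (l : list mode) (t : R) :
  eval mu (lag r a mu l) t = r * (a * eval mu l t - eval mu l (t - 1)).
Proof.
induction l as [|m l IH]; [simpl; ring|].
cbn [lag map]; fold (lag r a mu l); rewrite !eval_cons, IH, expo_shift; unfold expo; simpl; ring.
Qed.

Lemma norm1_lag (r a mu : R) (l : list mode) :
  0 <= r -> 0 <= a <= 1 -> 0 <= mu -> norm1 (lag r a mu l) <= 2 * r * norm1 l.
Proof.
intros hr ha hmu; induction l as [|m l IH]; [simpl; lra|].
cbn [lag map]; fold (lag r a mu l); rewrite !norm1_cons; cbn [amp]; rewrite !Cmod_mult, Cmod_R, Rabs_pos_eq by lra.
assert (h : Cmod (a - shift_factor (INR (S (deg m)) * mu) (freq m)) <= 2).
{ unfold Cminus; eapply Rle_trans; [apply Cmod_triangle|].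
  rewrite Cmod_opp, Cmod_R, Rabs_pos_eq by lra.
  assert (h := shift_factor_bound (INR (S (deg m)) * mu) (freq m)
    (Rmult_le_pos _ _ (pos_INR _) hmu)); lra. }
assert (hc := Cmod_ge_0 (amp m)).
assert (r * Cmod (a - shift_factor (INR (S (deg m)) * mu) (freq m)) * Cmod (amp m)
        <= r * 2 * Cmod (amp m)).
{ apply Rmult_le_compat_r; [exact hc|]. now apply Rmult_le_compat_l. }
lra.
Qed.

(** Modes of degrees [d] and [d'] have rates [(d + 1) mu] and [(d' + 1) mu]; their product has rate
    [(d + d' + 2) mu], hence degree [S k] with [k = d + d']. *)
Definition solve_mode (p q mu : R) (k : nat) (nu : R) (c : C) : mode :=
  Mode (S k) nu (c / char_fun p q (INR (S (S k)) * mu) nu)%C.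

Definition mode_prod_solve (p q mu : R) (m : mode) (l : list mode) : list mode :=
  flat_map (fun m' =>
    solve_mode p q mu (deg m + deg m') (freq m + freq m') (amp m * amp m' / 2)%C ::
    solve_mode p q mu (deg m + deg m') (freq m - freq m') (amp m * Cconj (amp m') / 2)%C ::
    nil) l.

(** Solution of [y' = p y - q y(t-1) + l l'], see [prod_solve_solution]. *)
Definition prod_solve (p q mu : R) (l l' : list mode) : list mode :=
  flat_map (fun m => mode_prod_solve p q mu m l') l.

(** * The linear delay equation with a product as forcing *)

Definition delay_solution (p q : R) (y g : R -> R) : Prop :=
  forall t, is_derive y t (p * y t - q * y (t - 1) + g t).

Lemma delay_solution_plus (p q : R) (y y' g g' h : R -> R) (z : R -> R) :
  delay_solution p q y g -> delay_solution p q y' g' ->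
  (forall t, z t = y t + y' t) -> (forall t, h t = g t + g' t) ->
  delay_solution p q z h.
Proof.
intros hy hy' hz hh t.
apply (is_derive_ext (fun u => y u + y' u)); [intros u; now rewrite hz|].
rewrite !hz, hh.
replace (_ + _) with (plus (p * y t - q * y (t - 1) + g t) (p * y' t - q * y' (t - 1) + g' t))
  by (unfold plus; simpl; ring).
apply (@is_derive_plus R_AbsRing R_NormedModule); auto.
Qed.

Lemma delay_solution_0 (p q : R) (g : R -> R) :
  (forall t, g t = 0) -> delay_solution p q (fun _ => 0) g.
Proof. intros hg t; rewrite hg; auto_derive; [trivial | ring]. Qed.

Lemma solve_mode_solution (p q mu : R) (k : nat) (nu : R) (c : C) :
  char_fun p q (INR (S (S k)) * mu) nu <> 0%C ->
  let m := solve_mode p q mu k nu c in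
  delay_solution p q (expo (INR (S (deg m)) * mu) (freq m) (amp m))
    (expo (INR (S (S k)) * mu) nu c).
Proof.
intros hne m t; cbn [deg freq amp].
replace (expo (INR (S (S k)) * mu) nu c t)
  with (expo (INR (S (S k)) * mu) nu
    (c / char_fun p q (INR (S (S k)) * mu) nu * char_fun p q (INR (S (S k)) * mu) nu)%C t).
- apply expo_char.
- f_equal; field; exact hne.
Qed.

Lemma mode_prod_solve_solution (p q mu : R) (m : mode) (l : list mode) :
  (forall k nu, char_fun p q (INR (S (S k)) * mu) nu <> 0%C) ->
  delay_solution p q (eval mu (mode_prod_solve p q mu m l))
    (fun t => expo (INR (S (deg m)) * mu) (freq m) (amp m) t * eval mu l t).
Proof.
intros hne; induction l as [|m' l IH].
- apply delay_solution_0; intros t; apply Rmult_0_r.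
- assert (hm := solve_mode_solution p q mu (deg m + deg m') (freq m + freq m')
    (amp m * amp m' / 2)%C (hne _ _)).
  assert (hm' := solve_mode_solution p q mu (deg m + deg m') (freq m - freq m')
    (amp m * Cconj (amp m') / 2)%C (hne _ _)).
  cbv zeta in hm, hm'.
  assert (hsum := delay_solution_plus _ _ _ _ _ _ _ _ hm hm'
     (fun t => eq_refl) (fun t => eq_refl)).
  apply (delay_solution_plus _ _ _ _ _ _ _ _ hsum IH).
  + intros t; simpl mode_prod_solve; fold (mode_prod_solve p q mu m l).
    rewrite !eval_cons; ring.
  + intros t; rewrite eval_cons, Rmult_plus_distr_l, expo_mult.
    replace (INR (S (S (deg m + deg m'))) * mu)
      with (INR (S (deg m)) * mu + INR (S (deg m')) * mu)
      by (rewrite !S_INR, plus_INR; ring).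
    reflexivity.
Qed.

Lemma prod_solve_solution (p q mu : R) (l l' : list mode) :
  (forall k nu, char_fun p q (INR (S (S k)) * mu) nu <> 0%C) ->
  delay_solution p q (eval mu (prod_solve p q mu l l')) (fun t => eval mu l t * eval mu l' t).
Proof.
intros hne; induction l as [|m l IH].
- apply delay_solution_0; intros t; apply Rmult_0_l.
- eapply delay_solution_plus;
    [apply (mode_prod_solve_solution _ _ _ m l' hne) | exact IH | intros t; apply eval_app |].
  intros t; rewrite eval_cons; ring.
Qed.

(** A pair of modes yields two modes, each of amplitude at most half the product of theirs divided
    by [c]. *)
Lemma norm1_prod_solve (p q mu c : R) (l l' : list mode) :
  0 < c -> (forall k nu, c <= Cmod (char_fun p q (INR (S (S k)) * mu) nu)) ->
  norm1 (prod_solve p q mu l l') <= norm1 l * norm1 l' / c.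
Proof.
intros hc hlow.
assert (hmode : forall k nu z, Cmod (amp (solve_mode p q mu k nu (z / 2)%C)) <= Cmod z / 2 / c).
{ intros k nu z; specialize (hlow k nu); unfold solve_mode; cbn [amp].
  rewrite !Cmod_div, (Cmod_R 2), Rabs_pos_eq by
    (try lra; try (apply Cmod_gt_0; lra); intros e; injection e; lra).
  apply Rmult_le_compat_l.
  - assert (h := Cmod_ge_0 z); lra.
  - apply Rinv_le_contravar; assumption. }
assert (hm : forall m, norm1 (mode_prod_solve p q mu m l') <= Cmod (amp m) * norm1 l' / c).
{ intros m; induction l' as [|m' l' IH].
  - simpl; lra.
  - simpl mode_prod_solve; fold (mode_prod_solve p q mu m l'); rewrite !norm1_cons.
    assert (h1 := hmode (deg m + deg m')%nat (freq m + freq m') (amp m * amp m')%C).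
    assert (h2 := hmode (deg m + deg m')%nat (freq m - freq m') (amp m * Cconj (amp m'))%C).
    rewrite Cmod_mult in h1, h2; rewrite Cmod_conj in h2.
    unfold Rdiv in *; rewrite Rmult_plus_distr_l, Rmult_plus_distr_r; lra. }
induction l as [|m l IH].
- simpl; lra.
- unfold prod_solve in *; simpl flat_map; rewrite norm1_app, norm1_cons.
  specialize (hm m); unfold Rdiv in *; rewrite !Rmult_plus_distr_r; lra.
Qed.

(** * Picard iteration and its limit *)

(** The pair of an approximation and of the next increment.  Differences of the quadratic
    term are expanded bilinearly, since cancellation is not visible in [norm1]. *)
Fixpoint picard (p q r a mu om eps : R) (n : nat) : list mode * list mode :=
  match n with
  | O => (nil, Mode 0 om (RtoC eps) :: nil)
  | S n =>
    let (z, d) := picard p q r a mu om eps n in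
    (z ++ d, prod_solve p q mu (z ++ d) (lag r a mu d) ++ prod_solve p q mu d (lag r a mu z))
  end.

(** With [Z] and [D] the norms of [z] and [d], the next increment has norm at most
    [2 r D (2 Z + D) / c]. As [2 Z + D <= 4 eps], the smallness of [eps] makes this at most [D / 4];
    the bound on [z] is the partial geometric sum. *)
Lemma picard_norm1 (p q r a mu om eps c : R) (n : nat) :
  0 <= r -> 0 <= a <= 1 -> 0 <= mu -> 0 < c -> 0 <= eps -> 32 * r * eps <= c ->
  (forall k nu, c <= Cmod (char_fun p q (INR (S (S k)) * mu) nu)) ->
  let (z, d) := picard p q r a mu om eps n in
  norm1 z <= 4 / 3 * eps * (1 - (1 / 4) ^ n) /\ norm1 d <= eps * (1 / 4) ^ n.
Proof.
intros hr ha hmu hc heps hsmall hlow.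
induction n as [|n IH].
- cbn [picard]; rewrite norm1_cons; cbn [amp]; rewrite Cmod_R, Rabs_pos_eq by lra.
  simpl; lra.
- cbn [picard]; destruct (picard p q r a mu om eps n) as [z d]; destruct IH as [hz hd].
  assert (hz0 := norm1_ge_0 z); assert (hd0 := norm1_ge_0 d).
  assert (hx : 0 < (1 / 4) ^ n) by (apply pow_lt; lra).
  assert (hx1 : (1 / 4) ^ n <= 1).
  { assert (h := pow_incr (1 / 4) 1 n ltac:(lra)); rewrite pow1 in h; exact h. }
  rewrite !norm1_app; simpl pow; set (x := (1 / 4) ^ n) in *.
  split; [lra|].
  assert (h1 := norm1_prod_solve p q mu c (z ++ d) (lag r a mu d) hc hlow).
  assert (h2 := norm1_prod_solve p q mu c d (lag r a mu z) hc hlow).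
  rewrite norm1_app in h1.
  assert (hlz := norm1_lag r a mu z hr ha hmu); assert (hld := norm1_lag r a mu d hr ha hmu).
  set (Z := norm1 z) in *; set (D := norm1 d) in *.
  assert (h3 : (Z + D) * norm1 (lag r a mu d) <= (Z + D) * (2 * r * D))
    by (apply Rmult_le_compat_l; lra).
  assert (h4 : D * norm1 (lag r a mu z) <= D * (2 * r * Z)) by (apply Rmult_le_compat_l; lra).
  assert (h5 : (Z + D) * (2 * r * D) + D * (2 * r * Z) <= D * (8 * r * eps)).
  { assert (2 * Z + D <= 4 * eps) by nra.
    replace ((Z + D) * (2 * r * D) + D * (2 * r * Z)) with ((D * (2 * r)) * (2 * Z + D)) by ring.
    replace (D * (8 * r * eps)) with ((D * (2 * r)) * (4 * eps)) by ring.
    apply Rmult_le_compat_l; [nra | assumption]. }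
  assert (h6 : D * (8 * r * eps) <= D * (c / 4)) by (apply Rmult_le_compat_l; lra).
  assert (h7 : ((Z + D) * norm1 (lag r a mu d) + D * norm1 (lag r a mu z)) / c <= D / 4).
  { apply (Rmult_le_reg_r c); [lra|]. unfold Rdiv at 1; rewrite Rmult_assoc, Rinv_l; lra. }
  unfold Rdiv in *; lra.
Qed.

(** The first approximation is the eigenmode, which solves the homogeneous equation; each later
    increment solves the linear equation forced by the change of the quadratic term. *)
Lemma picard_solution (p q r a mu om eps : R) (n : nat) :
  char_fun p q mu om = 0%C ->
  (forall k nu, char_fun p q (INR (S (S k)) * mu) nu <> 0%C) ->
  let Z n := eval mu (fst (picard p q r a mu om eps n)) in
  delay_solution p q (Z (S n)) (fun t => Z n t * (r * (a * Z n t - Z n (t - 1)))).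
Proof.
intros h0 hne Z.
assert (hS : forall n t, Z (S n) t = Z n t + eval mu (snd (picard p q r a mu om eps n)) t).
{ intros k t; unfold Z; cbn [picard]; destruct (picard p q r a mu om eps k) as [z d].
  apply eval_app. }
induction n as [|n IH].
- intros t; unfold Z; cbn [picard fst app].
  apply (is_derive_ext (expo mu om (RtoC eps))).
  { intros u; rewrite eval_cons; cbn [deg freq amp eval fold_right].
    rewrite Rplus_0_r; f_equal; simpl; ring. }
  rewrite !eval_cons; cbn [deg freq amp eval fold_right].
  replace (INR 1 * mu) with mu by (simpl; ring).
  replace (_ + _) with
    (p * expo mu om (RtoC eps) t - q * expo mu om (RtoC eps) (t - 1)
     + expo mu om (RtoC eps * char_fun p q mu om)%C t).
  + apply expo_char.
  + rewrite h0; unfold expo; simpl; ring.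
- set (g := fun n t => Z n t * (r * (a * Z n t - Z n (t - 1)))).
  assert (hd : delay_solution p q (eval mu (snd (picard p q r a mu om eps (S n))))
            (fun t => g (S n) t - g n t)).
  { revert hS; unfold g, Z; cbn [picard].
    destruct (picard p q r a mu om eps n) as [z d]; cbn [fst snd]; intros _.
    eapply delay_solution_plus;
      [apply (prod_solve_solution _ _ _ (z ++ d) (lag r a mu d) hne) |
       apply (prod_solve_solution _ _ _ d (lag r a mu z) hne) |
       intros t; apply eval_app |].
    (* With [L] for [lag]: [(z + d) L(z + d) - z L(z) = (z + d) L(d) + d L(z)]. *)
    intros t; cbv beta; rewrite !eval_lag, !eval_app; ring. }
  apply (delay_solution_plus _ _ _ _ _ _ _ _ IH hd).
  + intros t; apply hS.
  + intros t; unfold g; ring.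
Qed.

(** The right-hand sides converge uniformly on [t <= 0], so the limit may be differentiated
    termwise. *)
Lemma quadratic_delay_limit (p q r a B : R) (Z : nat -> R -> R) (z : R -> R) :
  (forall n t, continuity_pt (Z n) t) ->
  (forall n t, t <= 0 -> Rabs (Z n t) <= B) ->
  (forall n t, t <= 0 -> Rabs (z t - Z n t) <= B * (1 / 4) ^ n) ->
  (forall n, delay_solution p q (Z (S n)) (fun t => Z n t * (r * (a * Z n t - Z n (t - 1))))) ->
  forall t, t < 0 ->
    is_derive z t (p * z t - q * z (t - 1) + z t * (r * (a * z t - z (t - 1)))).
Proof.
intros hcont hB herr hsol.
set (rhs := fun u v w w1 : R => p * u - q * v + w * (r * (a * w - w1))).
assert (hB0 : 0 <= B).
{ eapply Rle_trans; [apply (Rabs_pos (Z 0%nat 0)) | apply hB; lra]. }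
assert (hzB : forall t, t <= 0 -> Rabs (z t) <= 2 * B).
{ intros t ht; replace (z t) with ((z t - Z 0%nat t) + Z 0%nat t) by ring.
  eapply Rle_trans; [apply Rabs_triang|].
  assert (h1 := herr 0%nat t ht); assert (h2 := hB 0%nat t ht); simpl in h1; lra. }
(* Error constant of [rhs] for arguments bounded by [2 B]; the error size [B] of the approximations
   is included. *)
set (K := B * (Rabs p + Rabs q) + 4 * B * B * Rabs r * (Rabs a + 1)).
assert (hK : 0 <= K).
{ assert (h1 := Rabs_pos p); assert (h2 := Rabs_pos q); assert (h3 := Rabs_pos r).
  assert (h4 := Rabs_pos a); unfold K.
  assert (0 <= B * (Rabs p + Rabs q)) by nra.
  assert (0 <= 4 * B * B) by nra.
  assert (0 <= Rabs r * (Rabs a + 1)) by nra.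
  rewrite Rmult_assoc; nra. }
assert (hdiff : forall n t, t <= 0 ->
  Rabs (rhs (z t) (z (t - 1)) (z t) (z (t - 1))
        - rhs (Z (S n) t) (Z (S n) (t - 1)) (Z n t) (Z n (t - 1))) <= K * (1 / 4) ^ n).
{ intros n t ht.
  assert (hx : 0 < (1 / 4) ^ n) by (apply pow_lt; lra).
  assert (e1 : Rabs (z t - Z (S n) t) <= B * (1 / 4) ^ n).
  { assert (h := herr (S n) t ht); simpl in h; nra. }
  assert (e2 : Rabs (z (t - 1) - Z (S n) (t - 1)) <= B * (1 / 4) ^ n).
  { assert (h := herr (S n) (t - 1) ltac:(lra)); simpl in h; nra. }
  assert (e3 := herr n t ht); assert (e4 := herr n (t - 1) ltac:(lra)).
  assert (b1 := hzB t ht); assert (b2 := hB n t ht).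
  assert (b3 := hzB (t - 1) ltac:(lra)); assert (b4 := hB n (t - 1) ltac:(lra)).
  set (x := (1 / 4) ^ n) in *.
  unfold rhs.
  (* The quadratic part uses [w (a w - w1) - W (a W - W1) = (w - W) (a (w + W) - w1) - W (w1 -
     W1)]. *)
  match goal with |- Rabs ?e <= _ => replace e with
    (p * (z t - Z (S n) t) - q * (z (t - 1) - Z (S n) (t - 1))
     + r * ((z t - Z n t) * (a * (z t + Z n t) - z (t - 1))
            - Z n t * (z (t - 1) - Z n (t - 1)))) by ring end.
  eapply Rle_trans; [apply Rabs_triang|].
  unfold K; rewrite Rmult_plus_distr_r; apply Rplus_le_compat.
  - eapply Rle_trans; [apply Rabs_triang|].
    rewrite Rabs_Ropp, !Rabs_mult.
    assert (h1 := Rabs_pos p); assert (h2 := Rabs_pos q).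
    replace (B * (Rabs p + Rabs q) * x) with (Rabs p * (B * x) + Rabs q * (B * x)) by ring.
    apply Rplus_le_compat; apply Rmult_le_compat_l; assumption.
  - rewrite Rabs_mult.
    replace (4 * B * B * Rabs r * (Rabs a + 1) * x)
      with (Rabs r * (4 * B * B * (Rabs a + 1) * x)) by ring.
    apply Rmult_le_compat_l; [apply Rabs_pos|].
    eapply Rle_trans; [apply Rabs_triang|].
    rewrite Rabs_Ropp, !Rabs_mult.
    assert (h5 : Rabs (a * (z t + Z n t) - z (t - 1)) <= Rabs a * (3 * B) + 2 * B).
    { eapply Rle_trans; [apply Rabs_triang|]. rewrite Rabs_Ropp, Rabs_mult.
      apply Rplus_le_compat; [|assumption].
      apply Rmult_le_compat_l; [apply Rabs_pos|].
      eapply Rle_trans; [apply Rabs_triang | lra]. }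
    assert (h6 : Rabs (z t - Z n t) * Rabs (a * (z t + Z n t) - z (t - 1))
                 <= B * x * (Rabs a * (3 * B) + 2 * B))
      by (apply Rmult_le_compat; auto using Rabs_pos).
    assert (h7 : Rabs (Z n t) * Rabs (z (t - 1) - Z n (t - 1)) <= B * (B * x))
      by (apply Rmult_le_compat; auto using Rabs_pos).
    assert (h8 : 0 <= B * B * x * Rabs a).
    { apply Rmult_le_pos; [|apply Rabs_pos]. apply Rmult_le_pos; nra. }
    assert (h9 : 0 <= B * B * x) by (apply Rmult_le_pos; nra).
    lra. }
assert (hlim : forall C e, 0 < e -> exists N, forall n, (N <= n)%nat -> C * (1 / 4) ^ n < e).
{ intros C e he.
  destruct (pow_lt_1_zero (1 / 4) ltac:(rewrite Rabs_pos_eq; lra) (e / (Rabs C + 1))) as [N hN].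
  { apply Rdiv_lt_0_compat; [lra|]. assert (h := Rabs_pos C); lra. }
  exists N; intros n hn; specialize (hN n hn).
  assert (hx : 0 < (1 / 4) ^ n) by (apply pow_lt; lra).
  rewrite Rabs_pos_eq in hN by lra.
  assert (h := Rabs_pos C); assert (h' := Rle_abs C).
  apply Rle_lt_trans with ((Rabs C + 1) * (1 / 4) ^ n); [nra|].
  apply (Rmult_lt_compat_l (Rabs C + 1)) in hN; [|lra].
  replace ((Rabs C + 1) * (e / (Rabs C + 1))) with e in hN by (field; lra); exact hN. }
intros t ht.
(* The ball of radius [- t] around [t] stays in the negative half-line. *)
set (rad := mkposreal (- t) ltac:(lra)).
assert (hball : forall y, Boule t rad y -> y < 0).
{ intros y hy; unfold Boule in hy; simpl in hy; apply Rabs_lt_between in hy; lra. }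
assert (hCVU : CVU (fun n t => rhs (Z (S n) t) (Z (S n) (t - 1)) (Z n t) (Z n (t - 1)))
         (fun t => rhs (z t) (z (t - 1)) (z t) (z (t - 1))) t rad).
{ intros e he; destruct (hlim K e he) as [N hN]; exists N; intros n y hn hy.
  specialize (hball y hy); specialize (hN n hn).
  eapply Rle_lt_trans; [apply hdiff; lra | exact hN]. }
apply is_derive_Reals.
apply (derivable_pt_lim_CVU (fun n => Z (S n))
  (fun n t => rhs (Z (S n) t) (Z (S n) (t - 1)) (Z n t) (Z n (t - 1)))
  z (fun t => rhs (z t) (z (t - 1)) (z t) (z (t - 1))) t t rad).
- unfold Boule; simpl; rewrite Rminus_diag, Rabs_R0; lra.
- intros y n _; apply is_derive_Reals, hsol.
- intros y hy e he; destruct (hlim B e he) as [N hN]; exists N; intros n hn.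
  specialize (hball y hy); specialize (hN (S n) ltac:(lia)).
  unfold Rdist; rewrite Rabs_minus_sym.
  eapply Rle_lt_trans; [apply herr; lra | exact hN].
- exact hCVU.
- apply (CVU_continuity _ _ _ _ hCVU).
  intros n y _.
  assert (hsh : forall n, continuity_pt (fun t => Z n (t - 1)) y).
  { intros k; apply (continuity_pt_comp (fun t => t - 1) (Z k)); [|apply hcont].
    apply continuity_pt_minus; [apply continuity_pt_id | apply continuity_pt_const; now intros ? ?]. }
  assert (hsc : forall c f, continuity_pt f y -> continuity_pt (fun t => c * f t) y).
  { intros c f hf; now apply (continuity_pt_scal f c y). }
  unfold rhs.
  apply (continuity_pt_plus (fun t => p * Z (S n) t - q * Z (S n) (t - 1))
     (fun t => Z n t * (r * (a * Z n t - Z n (t - 1))))).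
  + apply (continuity_pt_minus (fun t => p * Z (S n) t) (fun t => q * Z (S n) (t - 1)));
      apply hsc; auto.
  + apply (continuity_pt_mult (Z n) (fun t => r * (a * Z n t - Z n (t - 1)))); [auto|].
    apply hsc, (continuity_pt_minus (fun t => a * Z n t) (fun t => Z n (t - 1))); auto.
Qed.

(** The solution is the series of the Picard increments, whose tails are dominated by geometric
    series of ratio [1/4]. *)
Lemma unstable_solution (p q r a mu om c : R) :
  0 < r -> 0 <= a <= 1 -> 0 < mu -> 0 < c ->
  char_fun p q mu om = 0%C ->
  (forall k nu, c <= Cmod (char_fun p q (INR (S (S k)) * mu) nu)) ->
  exists z M t0, t0 < 0 /\ z t0 <> 0 /\
    (forall t, t <= 0 -> Rabs (z t) <= M * exp (mu * t)) /\
    forall t, t < 0 ->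
      is_derive z t (p * z t - q * z (t - 1) + z t * (r * (a * z t - z (t - 1)))).
Proof.
intros hr ha hmu hc h0 hlow.
(* The largest amplitude that [picard_norm1] admits. *)
set (eps := c / (32 * r)).
assert (heps : 0 < eps) by (apply Rdiv_lt_0_compat; lra).
assert (hsmall : 32 * r * eps <= c) by (unfold eps; right; field; lra).
assert (hne : forall k nu, char_fun p q (INR (S (S k)) * mu) nu <> 0%C).
{ intros k nu; apply Cmod_gt_0; specialize (hlow k nu); lra. }
set (Z := fun n => eval mu (fst (picard p q r a mu om eps n))).
set (D := fun n => eval mu (snd (picard p q r a mu om eps n))).
assert (hZS : forall n t, Z (S n) t = Z n t + D n t).
{ intros n t; unfold Z, D; cbn [picard]; destruct (picard p q r a mu om eps n) as [z d].
  apply eval_app. }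
assert (hD : forall n t, t <= 0 -> Rabs (D n t) <= eps * exp (mu * t) * (1 / 4) ^ n).
{ intros n t ht; assert (h := picard_norm1 p q r a mu om eps c n
    ltac:(lra) ha ltac:(lra) hc ltac:(lra) hsmall hlow).
  unfold D; destruct (picard p q r a mu om eps n) as [z d]; destruct h as [_ h].
  eapply Rle_trans; [apply eval_bound; lra|].
  assert (he := exp_pos (mu * t)).
  replace (eps * exp (mu * t) * (1 / 4) ^ n) with (eps * (1 / 4) ^ n * exp (mu * t)) by ring.
  apply Rmult_le_compat_r; simpl; lra. }
assert (hgeom : forall C, is_series (fun n => C * (1 / 4) ^ n) (C * (4 / 3))).
{ intros C; replace (4 / 3) with (/ (1 - 1 / 4)) by field.
  apply (is_series_scal_l C (fun n => (1 / 4) ^ n)), is_series_geom.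
  rewrite Rabs_pos_eq; lra. }
assert (hex : forall n t, t <= 0 -> ex_series (fun k => D (n + k)%nat t)).
{ intros n t ht; apply (@ex_series_le R_AbsRing R_CompleteNormedModule _
    (fun k => eps * exp (mu * t) * (1 / 4) ^ n * (1 / 4) ^ k)).
  - intros k; change (Rabs (D (n + k)%nat t) <= eps * exp (mu * t) * (1 / 4) ^ n * (1 / 4) ^ k).
    rewrite Rmult_assoc, <- pow_add; now apply hD.
  - eexists; apply hgeom. }
set (z := fun t => Series (fun n => D n t)).
assert (htail : forall n t, t <= 0 -> z t = Z n t + Series (fun k => D (n + k)%nat t)).
{ intros n t ht; induction n as [|n IH].
  - unfold z, Z; simpl; ring.
  - rewrite IH, hZS, Series_incr_1 by now apply hex.
    rewrite Nat.add_0_r, Rplus_assoc; do 2 f_equal.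
    apply Series_ext; intros k; f_equal; lia. }
assert (herr : forall n t, t <= 0 ->
          Rabs (z t - Z n t) <= 4 / 3 * eps * exp (mu * t) * (1 / 4) ^ n).
{ intros n t ht; rewrite (htail n t ht).
  replace (Z n t + Series (fun k => D (n + k)%nat t) - Z n t)
    with (Series (fun k => D (n + k)%nat t)) by ring.
  assert (hb : forall k, Rabs (D (n + k)%nat t) <= eps * exp (mu * t) * (1 / 4) ^ n * (1 / 4) ^ k).
  { intros k; rewrite Rmult_assoc, <- pow_add; now apply hD. }
  replace (4 / 3 * eps * exp (mu * t) * (1 / 4) ^ n)
    with (eps * exp (mu * t) * (1 / 4) ^ n * (4 / 3)) by field.
  rewrite <- (is_series_unique _ _ (hgeom (eps * exp (mu * t) * (1 / 4) ^ n))).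
  eapply Rle_trans; [apply Series_Rabs | apply Series_le].
  - apply (@ex_series_le R_AbsRing R_CompleteNormedModule _
      (fun k => eps * exp (mu * t) * (1 / 4) ^ n * (1 / 4) ^ k)).
    + intros k; change (Rabs (Rabs (D (n + k)%nat t))
        <= eps * exp (mu * t) * (1 / 4) ^ n * (1 / 4) ^ k).
      rewrite Rabs_Rabsolu; apply hb.
    + eexists; apply hgeom.
  - intros k; split; [apply Rabs_pos | apply hb].
  - eexists; apply hgeom. }
assert (hexp : forall t, t <= 0 -> 0 < exp (mu * t) <= 1).
{ intros t ht; replace (mu * t) with (- (mu * - t)) by ring; apply exp_opp_bound; nra. }
(* At [t0] the eigenmode is at full amplitude [eps e^(mu t0)], the corrections at most a third. *)
assert (ht0 : exists t0, t0 < 0 /\ cos (om * t0) = 1).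
{ destruct (Rtotal_order om 0) as [h|[->|h]].
  - exists (2 * PI / om); split.
    + assert (hpi := PI_RGT_0); apply Rdiv_pos_neg; lra.
    + replace (om * (2 * PI / om)) with (2 * PI) by (field; lra); apply cos_2PI.
  - exists (-1); split; [lra | rewrite Rmult_0_l; apply cos_0].
  - exists (- (2 * PI / om)); split.
    + assert (hpi := PI_RGT_0); assert (0 < 2 * PI / om) by (apply Rdiv_lt_0_compat; lra); lra.
    + replace (om * - (2 * PI / om)) with (- (2 * PI)) by (field; lra).
      rewrite cos_neg; apply cos_2PI. }
destruct ht0 as [t0 [ht0 hcos]].
exists z, (4 / 3 * eps), t0; split; [exact ht0|]; split; [|split].
- intros hz; assert (h := herr 1%nat t0 ltac:(lra)).
  assert (hZ1 : Z 1%nat t0 = eps * exp (mu * t0)).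
  { unfold Z; cbn [picard fst app]; rewrite eval_cons; cbn [deg freq amp eval fold_right].
    unfold expo; replace (INR 1 * mu) with mu by (simpl; ring); rewrite hcos; simpl; ring. }
  rewrite hz, hZ1, Rminus_0_l, Rabs_Ropp, Rabs_pos_eq in h.
  + assert (0 < eps * exp (mu * t0)) by (apply Rmult_lt_0_compat; [lra | apply exp_pos]).
    simpl in h; lra.
  + apply Rmult_le_pos; [lra | left; apply exp_pos].
- intros t ht; assert (h := herr 0%nat t ht).
  replace (z t - Z 0%nat t) with (z t) in h by (unfold Z; simpl; ring); simpl in h; lra.
- apply (quadratic_delay_limit p q r a (4 / 3 * eps) Z z).
  + intros n t; apply eval_continuity.
  + intros n t ht; assert (h := picard_norm1 p q r a mu om eps c n
      ltac:(lra) ha ltac:(lra) hc ltac:(lra) hsmall hlow).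
    unfold Z; destruct (picard p q r a mu om eps n) as [y d]; destruct h as [h _].
    eapply Rle_trans; [apply eval_bound; lra|].
    assert (hx : 0 < (1 / 4) ^ n) by (apply pow_lt; lra).
    assert (he := hexp t ht); assert (hn := norm1_ge_0 y); cbn [fst]; nra.
  + intros n t ht; eapply Rle_trans; [apply herr, ht|].
    assert (hx : 0 < (1 / 4) ^ n) by (apply pow_lt; lra).
    assert (he := hexp t ht); apply Rmult_le_compat_r; nra.
  + intros n; now apply picard_solution.
Qed.

(** * Uniqueness of solutions and the failure of stability *)

Lemma sup_norm_le (f : R -> R) (M : R) :
  (forall th, history th -> Rabs (f th) <= M) -> sup_norm f <= M.
Proof.
intros h; unfold sup_norm.
set (E := fun y => exists theta, history theta /\ y = Rabs (f theta)).
assert (hl := Lub_Rbar_correct E).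
assert (h0 : E (Rabs (f 0))) by (exists 0; split; [unfold history; lra | reflexivity]).
destruct hl as [hub hlub].
specialize (hub _ h0); specialize (hlub (Finite M)).
(* The set is inhabited and bounded by [M], which rules out the infinite values, where [real] would
   return its default. *)
destruct (Lub_Rbar E) as [l| |]; simpl in *.
- apply hlub; intros y [th [hth ->]]; now apply h.
- exfalso; apply hlub; intros y [th [hth ->]]; now apply h.
- contradiction.
Qed.

(* On each unit interval the delayed terms agree, so the difference [d] of the solutions
   satisfies [d' = A d] with [A] bounded, and [e^(-2Kt) d^2] is nonincreasing. *)
Lemma delay_logistic_unique (r a B T : R) (x y : R -> R) :
  (forall t, -1 <= t <= 0 -> t < T -> x t = y t) ->
  (forall t, -1 <= t < T -> Rabs (x t) <= B /\ Rabs (y t) <= B) ->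
  (forall t, 0 <= t < T -> continuity_pt x t /\ continuity_pt y t) ->
  (forall t, 0 < t < T -> is_derive x t (delay_logistic r a (x t) (x (t - 1))) /\
                          is_derive y t (delay_logistic r a (y t) (y (t - 1)))) ->
  forall (n : nat) t, -1 <= t <= INR n -> t < T -> x t = y t.
Proof.
intros hinit hB hcont hder n; induction n as [|n IH]; intros t ht htT.
- apply hinit; simpl in ht; lra.
- destruct (Rle_lt_dec t (INR n)) as [hle|hlt]; [apply IH; lra|].
  assert (hn := pos_INR n); rewrite S_INR in ht.
  set (K := Rabs r * (1 + Rabs a * (2 * B) + B)).
  (* With a common delayed value [v], [x (1 + a x - v) - y (1 + a y - v) = (x - y) (1 + a (x + y) -
     v)]. *)
  set (A := fun s => r * (1 + a * (x s + y s) - x (s - 1))).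
  set (d := fun s => x s - y s).
  assert (hA : forall s, INR n <= s <= t -> A s <= K).
  { intros s hs; eapply Rle_trans; [apply Rle_abs|].
    destruct (hB s) as [b1 b2]; [lra|]; destruct (hB (s - 1)) as [b3 _]; [lra|].
    unfold A, K; rewrite Rabs_mult; apply Rmult_le_compat_l; [apply Rabs_pos|].
    eapply Rle_trans; [apply Rabs_triang|]; rewrite Rabs_Ropp.
    apply Rplus_le_compat; [|exact b3].
    eapply Rle_trans; [apply Rabs_triang|]; rewrite Rabs_R1, Rabs_mult.
    apply Rplus_le_compat_l, Rmult_le_compat_l; [apply Rabs_pos|].
    eapply Rle_trans; [apply Rabs_triang | lra]. }
  destruct (MVT_gen (fun s => exp (- (2 * K) * s) * (d s * d s)) (INR n) t
    (fun s => exp (- (2 * K) * s) * (2 * (A s - K) * (d s * d s)))) as [s [hs e]].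
  + intros s; rewrite Rmin_left, Rmax_right by lra; intros hs.
    destruct (hder s) as [hx hy]; [lra|].
    assert (hd : is_derive d s (A s * d s)).
    { replace (A s * d s) with (minus (delay_logistic r a (x s) (x (s - 1)))
        (delay_logistic r a (y s) (y (s - 1)))).
      - apply (@is_derive_minus R_AbsRing R_NormedModule); assumption.
      - rewrite <- (IH (s - 1)) by lra.
        unfold minus, plus, opp, A, d, delay_logistic; simpl; ring. }
    auto_derive; [repeat split; eexists; exact hd|].
    rewrite (is_derive_unique _ _ _ hd : Derive (fun s => d s) s = _); ring.
  + intros s; rewrite Rmin_left, Rmax_right by lra; intros hs.
    destruct (hcont s) as [hx hy]; [lra|].
    assert (hd : continuity_pt d s) by now apply continuity_pt_minus.
    apply (continuity_pt_mult (fun s => exp (- (2 * K) * s)) (fun s => d s * d s)).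
    * apply continuity_pt_filterlim, (ex_derive_continuous (fun s => exp (- (2 * K) * s))).
      auto_derive; trivial.
    * now apply (continuity_pt_mult d d).
  + rewrite Rmin_left, Rmax_right in hs by lra.
    assert (hdn : d (INR n) = 0) by (unfold d; rewrite (IH (INR n)) by lra; ring).
    rewrite hdn in e.
    assert (h1 := exp_pos (- (2 * K) * s)); assert (h2 := exp_pos (- (2 * K) * t)).
    specialize (hA s hs).
    assert (h3 : exp (- (2 * K) * s) * (2 * (K - A s) * (d s * d s)) * (t - INR n) >= 0).
    { apply Rle_ge, Rmult_le_pos; [|lra].
      apply Rmult_le_pos; [lra|]. apply Rmult_le_pos; nra. }
    assert (h4 : exp (- (2 * K) * t) * (d t * d t) <= 0) by nra.
    destruct (Req_dec (d t) 0) as [hd|hd]; [unfold d in hd; lra|].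
    assert (h5 : 0 < exp (- (2 * K) * t) * (d t * d t))
      by (apply Rmult_lt_0_compat; [exact h2 | now apply Rsqr_pos_lt]).
    lra.
Qed.

Lemma exp_tends_to_0 (mu M e : R) :
  0 < mu -> 0 < e -> exists T0, forall t, t <= T0 -> M * exp (mu * t) < e.
Proof.
intros hmu he.
exists (ln (e / (Rabs M + 1)) / mu - 1); intros t ht.
assert (hM := Rabs_pos M).
assert (h : mu * t < ln (e / (Rabs M + 1))).
{ apply Rlt_le_trans with (mu * (ln (e / (Rabs M + 1)) / mu)).
  - apply Rmult_lt_compat_l; lra.
  - right; field; lra. }
apply exp_increasing in h; rewrite exp_ln in h by (apply Rdiv_lt_0_compat; lra).
apply Rle_lt_trans with ((Rabs M + 1) * exp (mu * t)).
- apply Rmult_le_compat_r; [left; apply exp_pos|]. assert (h' := Rle_abs M); lra.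
- apply (Rmult_lt_compat_l (Rabs M + 1)) in h; [|lra].
  replace ((Rabs M + 1) * (e / (Rabs M + 1))) with e in h by (field; lra); exact h.
Qed.

(** Stability is contradicted at [eps = |z t0|]. The translate [y] solves the equation only before
    [T]; the existence part of stability supplies a global solution with the same initial function,
    and uniqueness identifies the two at time [T + t0]. *)
Lemma unstable_of_backward_solution (r a c mu M t0 : R) (z : R -> R) :
  0 < c -> 0 < mu -> t0 < 0 -> z t0 <> 0 ->
  (forall t, t <= 0 -> Rabs (z t) <= M * exp (mu * t)) ->
  (forall t, t < 0 -> is_derive z t (delay_logistic r a (c + z t) (c + z (t - 1)))) ->
  unstable r a c.
Proof.
intros hc hmu ht0 hz0 hdecay hder hst.
destruct (hst (Rabs (z t0))) as [del [hdel h]]; [now apply Rabs_pos_lt|].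
(* The bound [c] keeps the initial function positive, [del / 2] keeps its distance from [c] strictly
   below [del]. *)
destruct (exp_tends_to_0 mu M (Rmin c (del / 2)) hmu) as [T0 hT0].
{ apply Rmin_pos; lra. }
(* [1 - t0 <= T] makes [T + t0] positive, and [- T0 <= T] brings the whole history below [T0]. *)
set (T := Rmax 1 (Rmax (1 - t0) (- T0))).
assert (hT1 : 1 <= T) by apply Rmax_l.
assert (hT2 : 1 - t0 <= T) by (eapply Rle_trans; [apply Rmax_l | apply Rmax_r]).
assert (hT3 : - T0 <= T) by (eapply Rle_trans; [apply Rmax_r | apply Rmax_r]).
set (y := fun t => c + z (t - T)).
assert (hsmall : forall th, history th -> Rabs (z (th - T)) < Rmin c (del / 2)).
{ intros th hth; unfold history in hth.
  eapply Rle_lt_trans; [apply hdecay; lra | apply hT0; lra]. }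
assert (hyder : forall t, t < T -> is_derive y t (delay_logistic r a (y t) (y (t - 1)))).
{ intros t ht; assert (hd := hder (t - T) ltac:(lra)).
  unfold y; replace (t - 1 - T) with (t - T - 1) by ring.
  auto_derive; [eexists; exact hd|].
  rewrite (is_derive_unique _ _ _ hd : Derive (fun u => z u) (t + - T) = _); ring. }
assert (hycont : forall t, t < T -> continuity_pt y t).
{ intros t ht; apply continuity_pt_filterlim, (ex_derive_continuous y).
  eexists; now apply hyder. }
destruct (h y) as [[x hx] hclose].
- split.
  + intros th hth; apply (filterlim_filter_le_1 _ (filter_le_within _)).
    apply continuity_pt_filterlim, hycont; unfold history in hth; lra.
  + intros th hth; specialize (hsmall th hth).
    assert (hm := Rmin_l c (del / 2)); apply Rabs_lt_between in hsmall; unfold y; lra.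
- apply Rle_lt_trans with (del / 2); [|lra].
  apply sup_norm_le; intros th hth; unfold y.
  replace (c + z (th - T) - c) with (z (th - T)) by ring.
  specialize (hsmall th hth); assert (hm := Rmin_r c (del / 2)); lra.
- specialize (hclose x hx); destruct hx as [hxc [hxi hxd]].
  destruct (INR_unbounded T) as [n hn].
  assert (e : x (T + t0) = y (T + t0)).
  (* The bound covers [y] by the decay of [z], and [x] by its agreement with [y] on the history and
     by stability afterwards. *)
  { apply (delay_logistic_unique r a (c + Rabs (z t0) + Rabs M) T x y) with n; try lra.
    - intros t ht _; now apply hxi.
    - intros t ht.
      assert (hM0 := Rabs_pos M); assert (hz := Rabs_pos (z t0)).
      assert (hy : Rabs (y t) <= c + Rabs M).
      { unfold y; eapply Rle_trans; [apply Rabs_triang|]; rewrite (Rabs_pos_eq c) by lra.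
        apply Rplus_le_compat_l; eapply Rle_trans; [apply hdecay; lra|].
        assert (he := exp_opp_bound (mu * (T - t)) ltac:(nra)).
        replace (- (mu * (T - t))) with (mu * (t - T)) in he by ring.
        assert (hM := Rle_abs M); nra. }
      split; [|lra].
      destruct (Rle_lt_dec 0 t) as [h0|h0].
      + specialize (hclose t h0); replace (x t) with (x t - c + c) by ring.
        eapply Rle_trans; [apply Rabs_triang|]; rewrite (Rabs_pos_eq c); lra.
      + rewrite hxi by (unfold history; lra); lra.
    - intros t ht; split; [|apply hycont; lra].
      (* Here [t >= 0] is interior to [[-1,+oo)], so relative continuity is ordinary continuity. *)
      apply continuity_pt_filterlim; intros P hP.
      assert (hin : locally t (fun u => -1 <= u)).
      { exists (mkposreal 1 Rlt_0_1); intros u hu.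
        apply Rabs_lt_between in hu; unfold minus, plus, opp in hu; simpl in hu; lra. }
      assert (hxP : locally t (fun u => -1 <= u -> P (x u))) by exact (hxc t ltac:(lra) P hP).
      change (locally t (fun u => P (x u))); generalize (filter_and _ _ hin hxP).
      apply filter_imp; intros u [hu hPu]; exact (hPu hu).
    - intros t ht; split; [apply hxd | apply hyder]; lra. }
  specialize (hclose (T + t0) ltac:(lra)); rewrite e in hclose; unfold y in hclose.
  replace (c + z (T + t0 - T) - c) with (z t0) in hclose; [lra|].
  replace (T + t0 - T) with t0 by ring; ring.
Qed.

Theorem proposition3 (r alpha : R) (hr : 0 < r) (halpha : alpha = exp (- r)) :
  unstable r alpha (1 / (1 - alpha)).
Proof.
assert (ha : 0 < alpha < 1).
{ split; rewrite halpha; [apply exp_pos | rewrite <- exp_0; apply exp_increasing; lra]. }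
assert (hq : 0 < r / (1 - alpha)) by (apply Rdiv_lt_0_compat; lra).
destruct (nonresonant_root (r / (1 - alpha) * alpha) (r / (1 - alpha)))
  as [mu [om [hmu [hroot hne]]]]; [lra | now apply unstable_root |].
destruct (char_fun_lower_bound _ (r / (1 - alpha)) mu ltac:(lra) hmu hne) as [c [hc hlow]].
destruct (unstable_solution _ _ r alpha mu om c hr ltac:(lra) hmu hc hroot hlow)
  as [z [M [t0 [ht0 [hz0 [hdecay hder]]]]]].
apply (unstable_of_backward_solution r alpha _ mu M t0 z); try assumption.
- apply Rdiv_lt_0_compat; lra.
- intros t ht.
  (* At [c = 1 / (1 - alpha)] the constant terms cancel, [1 + alpha c - c = 0], and
     [r c = r / (1 - alpha)]. *)
  replace (delay_logistic _ _ _ _) with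
    (r / (1 - alpha) * alpha * z t - r / (1 - alpha) * z (t - 1)
      + z t * (r * (alpha * z t - z (t - 1)))) by (unfold delay_logistic; field; lra).
  now apply hder.
Qed.
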